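(* Let $f:\mathbb{R}^d\to\mathbb{R}$ be convex and Lipschitz-smooth with constant $L>0$, let $\psi:\mathbb{R}^d\to\mathbb{R}$ be continuous and convex, let $F=f+\psi$ and $\rho\in(0,1)$. If regular backtracking (BLS) or adaptive backtracking (ABLS), called at a point $y_k\in\mathbb{R}^d$, receives an initial step-size $\alpha_0>0$, then it returns a feasible step-size $\alpha_k$ such that $$\alpha_k\ \ge\ \min\{\alpha_0,\ \rho/L\}.$$
   Context: A differentiable $f$ is Lipschitz-smooth with constant $L>0$ if $f(y)\le f(x)+\langle\nabla f(x),y-x\rangle+\frac L2\|y-x\|^2$ for all $x,y$. For $\alpha>0$ the proximal operator is $$p_\alpha(y)=\arg\min_x\Bigl\{\psi(x)+\frac1{2\alpha}\bigl\|x-(y-\alpha\nabla f(y))\bigr\|^2\Bigr\}.$$ A step-size $\alpha>0$ is feasible at $y$ if it satisfies the criterion $$F(p_\alpha(y))\le f(y)+\langle\nabla f(y),p_\alpha(y)-y\rangle+\frac1{2\alpha}\|p_\alpha(y)-y\|^2+\psi(p_\alpha(y)).$$ The violation at $y$ is $$v(\alpha)=\frac{\frac1{2\alpha}\|p_\alpha(y)-y\|^2}{f(p_\alpha(y))-f(y)-\langle\nabla f(y),p_\alpha(y)-y\rangle};$$ whenever the criterion fails, the denominator is positive and $v(\alpha)<1$. BLS at $y$: set $\alpha\gets\alpha_0$; while the criterion fails for $\alpha$, set $\alpha\gets\rho\alpha$; return $\alpha$. ABLS at $y$: the same with the update $\alpha\gets\hat\rho(v(\alpha))\,\alpha$, where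 $\hat\rho(v(\alpha))=\rho\,v(\alpha)$. *)

(* Defs.v *)
From HB Require Import structures.
From mathcomp Require Import all_boot all_order all_algebra.
From mathcomp Require Import all_classical all_reals all_analysis.

Set Implicit Arguments.
Unset Strict Implicit.
Unset Printing Implicit Defensive.

Import Order.TTheory GRing.Theory Num.Theory.
Import numFieldNormedType.Exports.

Local Open Scope classical_set_scope.
Local Open Scope ring_scope.

(* R^d is represented by row vectors. *)
Section Euclidean.
Context {R : realType} {d : nat}.
Implicit Types (f : 'rV[R]_d -> R) (x y u v : 'rV[R]_d).

Definition dot u v : R := \sum_(i < d) u 0 i * v 0 i.

(* The library norm `|u| on 'rV[R]_d is the sup norm. It induces the same
   topology and the same notion of differentiability as the Euclidean norm. *)
Definition enorm u : R := Num.sqrt (dot u u).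

Definition gradient f x : 'rV[R]_d :=
  \row_(i < d) 'd f x (delta_mx 0 i : 'rV[R]_d).

Definition lipschitz_smooth (L : R) f : Prop :=
  (forall x, differentiable f x) /\
  (forall x y,
     f y <= f x + dot (gradient f x) (y - x) + L / 2 * enorm (y - x) ^+ 2).

End Euclidean.

Section Backtracking.
Context {R : realType} {d : nat}.
Variables (f psi : 'rV[R]_d -> R).
Implicit Types (alpha beta rho : R) (x y : 'rV[R]_d).

Definition prox_objective alpha y x : R :=
  psi x
  + (2 * alpha)^-1 * enorm (x - (y - alpha *: gradient f y)) ^+ 2.

(* The argmin is selected by choice: for psi convex and continuous and
   alpha > 0 the objective is continuous, strongly convex and coercive, so it
   has exactly one minimizer and the default value 0 is not used. *)
Definition prox alpha y : 'rV[R]_d :=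
  xget 0 [set p | forall x,
    prox_objective alpha y p <= prox_objective alpha y x].

Definition criterion y alpha : bool :=
  let p := prox alpha y in
  (f \+ psi) p <= f y + dot (gradient f y) (p - y)
                  + (2 * alpha)^-1 * enorm (p - y) ^+ 2 + psi p.

Definition feasible y alpha : Prop := 0 < alpha /\ criterion y alpha.

Definition violation y alpha : R :=
  let p := prox alpha y in
  ((2 * alpha)^-1 * enorm (p - y) ^+ 2)
  / (f p - f y - dot (gradient f y) (p - y)).

(* backtracking y next alpha beta: the loop "while the criterion fails at y,
   replace alpha by next alpha", entered with alpha, terminates and returns
   beta. *)
Inductive backtracking y (next : R -> R) : R -> R -> Prop :=
| backtracking_stop alpha :
    criterion y alpha -> backtracking y next alpha alpha
| backtracking_step alpha beta :
    ~~ criterion y alpha -> backtracking y next (next alpha) beta ->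
    backtracking y next alpha beta.

Definition BLS rho y alpha0 alphak : Prop :=
  backtracking y (fun alpha => rho * alpha) alpha0 alphak.

Definition rho_hat rho (v : R) : R := rho * v.

Definition ABLS rho y alpha0 alphak : Prop :=
  backtracking y (fun alpha => rho_hat rho (violation y alpha) * alpha)
    alpha0 alphak.

End Backtracking.

(* Main.v *)
(* If the criterion fails at alpha with p the proximal point and
   D = f p - f y - <grad f y, p - y>, then
   |p - y|^2 / (2 alpha) < D <= L / 2 |p - y|^2 by smoothness. Hence
   1 / L < alpha and 1 / (alpha L) <= v alpha < 1, so both updates map alpha
   into [rho / L, rho alpha]: every rejected step-size is followed by one that
   is at least rho / L, and the geometric decay forces the loop to stop once
   alpha <= 1 / L. *)
Require Import Defs.
From HB Require Import structures.
From mathcomp Require Import all_boot all_order all_algebra.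
From mathcomp Require Import all_classical all_reals all_analysis.
From mathcomp Require Import ring lra.

Import Order.TTheory GRing.Theory Num.Theory.
Import numFieldNormedType.Exports.

Local Open Scope classical_set_scope.
Local Open Scope ring_scope.

Lemma criterion_fail_bounds (R : realType) (d : nat) (f psi : 'rV[R]_d -> R)
    (L alpha : R) (y : 'rV[R]_d) :
  0 < L -> lipschitz_smooth L f -> 0 < alpha -> ~~ criterion f psi y alpha ->
  [/\ 1 < L * alpha, (L * alpha)^-1 <= violation f psi y alpha
    & violation f psi y alpha < 1].
Proof.
move=> L0 [_ smooth] a0; rewrite /criterion /violation /=.
set p := prox _ _ _ _; rewrite -ltNge => fail.
have := smooth y p; set g := dot _ _ in fail *; set s := enorm _ ^+ 2 in fail *.
move=> le_s; set D := f p - f y - g.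
have s0 : 0 <= s by exact: sqr_ge0.
have N0 : 0 <= (2 * alpha)^-1 * s by rewrite mulr_ge0// invr_ge0; lra.
have ND : (2 * alpha)^-1 * s < D by rewrite /D; lra.
have DL : D <= L / 2 * s by rewrite /D; lra.
have D0 : 0 < D by exact: le_lt_trans ND.
have La0 : 0 < L * alpha by exact: mulr_gt0.
(* Factoring out the numerator of the violation turns the smoothness bound into one on the ratio. *)
have DLa : D <= (L * alpha) * ((2 * alpha)^-1 * s).
  suff <- : L / 2 * s = (L * alpha) * ((2 * alpha)^-1 * s) by [].
  by field; rewrite gt_eqF.
split.
(* If [L * alpha <= 1], then [DLa] bounds [D] by the numerator, against [ND]. *)
- by rewrite ltNge; apply/negP => La1; nra.
- by rewrite ler_pdivlMr// ler_pdivrMl.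
- by rewrite ltr_pdivrMr// mul1r.
Qed.

Arguments criterion_fail_bounds {R d f psi L alpha y}.

(** Common to both methods: the upper bound on [next] forces termination, the lower bound keeps the
    result large. *)
Lemma backtracking_returns (R : realType) (d : nat) (f psi : 'rV[R]_d -> R)
    (L rho : R) (y : 'rV[R]_d) (next : R -> R) (alpha0 : R) :
  0 < L -> lipschitz_smooth L f -> 0 < rho < 1 ->
  (forall alpha : R, 0 < alpha -> ~~ criterion f psi y alpha ->
     rho / L <= next alpha <= rho * alpha) ->
  0 < alpha0 ->
  exists alphak, [/\ backtracking f psi y next alpha0 alphak,
    feasible f psi y alphak & Num.min alpha0 (rho / L) <= alphak].
Proof.
move=> L0 smooth /andP[rho0 rho1] nextP a0.
(* This [n] bounds the number of rejections. *)
have [n small] : exists n, L * (rho ^+ n * alpha0) <= 1.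
  have /cvgrPdist_lt/(_ (L * alpha0)^-1) : rho ^+ n @[n --> \oo] --> (0 : R).
    by apply: cvg_expr; rewrite gtr0_norm.
  rewrite invr_gt0 mulr_gt0// => /(_ isT)[n _ /(_ n (leqnn n))] /=.
  rewrite sub0r normrN gtr0_norm ?exprn_gt0// => small; exists n.
  by rewrite mulrCA -ler_pdivlMr ?mulr_gt0// div1r ltW.
elim: n alpha0 a0 small => [|n IHn] alpha a0 small;
  have [ok|fail] := boolP (criterion f psi y alpha);
  try by exists alpha; split; [exact: backtracking_stop|split|rewrite ge_min lexx].
(* With no rejections left, [small] reads [L * alpha <= 1], so failure is impossible. *)
- have [] := criterion_fail_bounds L0 smooth a0 fail.
  by move: small; rewrite expr0 mul1r leNgt => /negbTE ->.
- have /andP[ge_next next_le] := nextP _ a0 fail.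
  have next0 : 0 < next alpha by apply: lt_le_trans ge_next; exact: divr_gt0.
  have [|alphak [run feas ge_k]] := IHn _ next0.
    (* The rejection uses up one factor [rho]. *)
    apply: le_trans small; rewrite ler_pM2l// exprSr -mulrA.
    by rewrite ler_pM2l// exprn_gt0.
  exists alphak; split=> //; first exact: backtracking_step run.
  (* As [rho / L <= next alpha], the minimum in [ge_k] is [rho / L], so the bound does not degrade
     over the iterations. *)
  apply: le_trans ge_k; rewrite ge_min; apply/orP; right.
  by rewrite le_min ge_next lexx.
Qed.

Theorem proposition11 (R : realType) (d : nat) (f psi : 'rV[R]_d -> R)
    (L rho : R) (yk : 'rV[R]_d) (alpha0 : R) :
  convex_function [set: 'rV[R]_d] f ->
  0 < L ->
  lipschitz_smooth L f ->
  continuous psi ->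
  convex_function [set: 'rV[R]_d] psi ->
  0 < rho < 1 ->
  0 < alpha0 ->
  (exists alphak : R,
     [/\ BLS f psi rho yk alpha0 alphak,
         feasible f psi yk alphak &
         Num.min alpha0 (rho / L) <= alphak]) /\
  (exists alphak : R,
     [/\ ABLS f psi rho yk alpha0 alphak,
         feasible f psi yk alphak &
         Num.min alpha0 (rho / L) <= alphak]).
Proof.
move=> _ L0 smooth _ _ rho01 a0; have /andP[rho0 _] := rho01.
split; apply: backtracking_returns => // alpha alpha_gt0 fail;
  have [La1 v_ge v_lt] :=
    criterion_fail_bounds L0 smooth alpha_gt0 fail.
- by rewrite lexx andbT ler_pM2l// -div1r ler_pdivrMr// mulrC ltW.
(* After cancelling [rho], the claim is [L^-1 <= v * alpha <= alpha] for the violation [v]. *)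
- rewrite /rho_hat -mulrA !ler_pM2l//; apply/andP; split; last first.
    by rewrite ger_pMl// ltW.
  by rewrite -ler_pdivrMr// -invfM mulrC (mulrC alpha).
Qed.
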